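(* Let $m\ge 1$, let $T$ be the $m$-adic rooted tree, and let $G\le \mathrm{Aut}~T$ be a self-similar profinite group (i.e. a self-similar closed subgroup of $\mathrm{Aut}~T$) with Haar measure $\mu_G$. Let $\mathcal{T}$ denote the action of the free monoid $T$ on $G$ by sections, $\mathcal{T}_v(g):=g|_v$ for $v\in T$, $g\in G$. Then: (i) if $G$ is fractal, then $(G,\mu_G,\mathcal{T},T)$ is a measure-preserving dynamical system; (ii) if $G$ is super strongly fractal, then $(G,\mu_G,\mathcal{T},T)$ is ergodic and strongly mixing.
   Context: Tree and automorphisms. The $m$-adic tree $T$ is identified with the free monoid of finite words over $\{1,\dots,m\}$ (the root is the empty word $\emptyset$, each word $v$ has the $m$ children $vx$, $x\in\{1,\dots,m\}$); the $n$th level is the set of words of length $n$. $\mathrm{Aut}~T$ is the group of bijections of the vertex set of $T$ preserving adjacency and fixing the root; it acts on the right, written $v\mapsto v^g$, and products $gh$ mean first $g$, then $h$. For $g\in\mathrm{Aut}~T$ and $v\in T$ the section $g|_v\in \mathrm{Aut}~T$ is the unique automorphism with $(vu)^g=v^g u^{g|_v}$ for all $u\in T$. One has $g|_{vw}=(g|_v)|_w$, so $\mathcal{T}_{vw}(g)=\mathcal{T}_w(\mathcal{T}_v(g))$. Topology. $\mathrm{St}(n)$ is the (normal, finite index) subgroup of automorphisms fixing every vertex of the $n$th level; $\mathrm{st}(v)$ is the stabilizer of the vertex $v$. $\mathrm{Aut}~T$ is a profinite group with the congruence topology, for which $\{\mathrm{St}(n)\}_{n\ge1}$ is a neighborhood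 basis of the identity; closed subgroups are profinite with the induced topology. For $G\le\mathrm{Aut}~T$ put $\mathrm{st}_G(v)=\mathrm{st}(v)\cap G$, $\mathrm{St}_G(n)=\mathrm{St}(n)\cap G$. $\varphi_v:\mathrm{st}(v)\to\mathrm{Aut}~T$ is the homomorphism $g\mapsto g|_v$. Self-similarity notions. $G$ is self-similar if $g|_v\in G$ for all $g\in G$, $v\in T$. $G$ is fractal if it is self-similar and $\varphi_v(\mathrm{st}_G(v))=G$ for every $v\in T$. $G$ is super strongly fractal if it is self-similar and $\varphi_v(\mathrm{St}_G(n))=G$ for every $n\ge1$ and every vertex $v$ at level $n$. Level-transitivity is not assumed. Dynamics. $\mu_G$ is the unique Haar probability measure on the Borel $\sigma$-algebra of the profinite group $G$. An action $\mathcal{T}$ of a monoid $A$ on a probability space $(X,\mu)$ is measure-preserving if $\mu(\mathcal{T}_a^{-1}(S))=\mu(S)$ for every measurable $S\subseteq X$ and every $a\in A$; then $(X,\mu,\mathcal{T},A)$ is called a measure-preserving dynamical system. It is ergodic if every measurable $S\subseteq X$ with $\mathcal{T}_a^{-1}(S)=S$ for all $a\in A$ satisfies $\mu(S)\in\{0,1\}$. If $A=F$ is a free monoid, it is strongly mixing if for all measurable $S_1,S_2\subseteq X$ and every sequence $\{a_k\}_{k\ge1}\subseteq F\setminus\{1\}$ (where $1$ is the identity of $F$, i.e. the empty word), the limit $\lim_{k\to\infty}\mu(\mathcal{T}_{a_1\cdots a_k}^{-1}(S_1)\cap S_2)$ exists and equals $\mu(S_1)\mu(S_2)$. *)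

(* Defs.v *)
From HB Require Import structures.
From mathcomp Require Import all_boot all_order all_algebra.
From mathcomp Require Import all_classical all_reals all_analysis.

Set Implicit Arguments.
Unset Strict Implicit.
Unset Printing Implicit Defensive.

Local Open Scope classical_set_scope.
Local Open Scope group_scope.

Definition freeMonoid (X : choiceType) : Type := seq X.

HB.instance Definition _ (X : choiceType) := Choice.on (freeMonoid X).
HB.instance Definition _ (X : choiceType) :=
  isMonoid.Build (freeMonoid X) (@catA X) (@cat0s X) (@cats0 X).

Definition tree (m : nat) := freeMonoid 'I_m.
HB.instance Definition _ m := Monoid.on (tree m).

Section Tree.
Context {m : nat}.
Implicit Types u v w : tree m.

Definition child u v : Prop := exists x : 'I_m, v = rcons u x.
Definition adjacent u v : Prop := child u v \/ child v u.

Record autT := AutT {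
  aut_fun :> tree m -> tree m;
  aut_bij : bijective aut_fun;
  aut_adj : forall u v, adjacent (aut_fun u) (aut_fun v) <-> adjacent u v;
  aut_root : aut_fun [::] = [::]
}.

HB.instance Definition _ := gen_eqMixin autT.
HB.instance Definition _ := gen_choiceMixin autT.

Lemma autP (g h : autT) : g =1 h -> g = h.
Proof.
case: g h => [f1 b1 a1 r1] [f2 b2 a2 r2] /= /funext E; subst f2.
by congr AutT; exact: Prop_irrelevance.
Qed.

Lemma aut_inj (g : autT) : injective g.
Proof. exact: bij_inj (aut_bij g). Qed.

Definition id_aut : autT :=
  @AutT id (Bijective (frefl _) (frefl _)) (fun _ _ => iff_refl _) erefl.

Definition comp_aut (g h : autT) : autT.
Proof.
exists (fun v => h (g v)).
- by have := bij_comp (aut_bij h) (aut_bij g).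
- by move=> u v; exact: iff_trans (aut_adj h _ _) (aut_adj g _ _).
- by rewrite !aut_root.
Defined.

Lemma inv_aut_ex (g : autT) : exists h : autT, cancel g h /\ cancel h g.
Proof.
have [h gK hK] := aut_bij g.
have hadj u v : adjacent (h u) (h v) <-> adjacent u v.
  by have := aut_adj g (h u) (h v); rewrite !hK; exact: iff_sym.
have hroot : h [::] = [::] by rewrite -[X in h X](aut_root g) gK.
by exists (AutT (Bijective hK gK) hadj hroot).
Qed.

Definition inv_aut (g : autT) : autT := sval (cid (inv_aut_ex g)).

Lemma inv_autK (g : autT) : cancel g (inv_aut g).
Proof. exact: (svalP (cid (inv_aut_ex g))).1. Qed.

Lemma inv_autVK (g : autT) : cancel (inv_aut g) g.
Proof. exact: (svalP (cid (inv_aut_ex g))).2. Qed.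

Let comp_autA : associative comp_aut. Proof. by move=> ? ? ?; exact: autP. Qed.
Let comp_1aut : left_id id_aut comp_aut. Proof. by move=> ?; exact: autP. Qed.
Let comp_aut1 : right_id id_aut comp_aut. Proof. by move=> ?; exact: autP. Qed.
Let comp_Vaut : left_inverse id_aut inv_aut comp_aut.
Proof. by move=> g; apply: autP => v /=; exact: inv_autVK. Qed.
Let comp_autV : right_inverse id_aut inv_aut comp_aut.
Proof. by move=> g; apply: autP => v /=; exact: inv_autK. Qed.

(* Automorphisms act on the right: [g * h] is "first g, then h". *)
HB.instance Definition _ :=
  isGroup.Build autT comp_autA comp_1aut comp_aut1 comp_Vaut comp_autV.

Lemma aut_rcons (g : autT) v x : exists y, g (rcons v x) = rcons (g v) y.
Proof.
elim/last_ind: v x => [|v x' IH] x.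
  have /(aut_adj g) : adjacent [::] (rcons [::] x) by left; exists x.
  by case=> [[y ->]|[y]]; [exists y | rewrite aut_root; case: (g _)].
have /(aut_adj g) : adjacent (rcons v x') (rcons (rcons v x') x).
  by left; exists x.
case=> [[y ->]|[y]]; first by exists y.
have [y' ->] := IH x' => /rcons_inj [/aut_inj /(congr1 size)].
by rewrite !size_rcons => /eqP; rewrite ltn_eqF.
Qed.

Lemma size_aut (g : autT) v : size (g v) = size v.
Proof.
elim/last_ind: v => [|v x IH]; first by rewrite aut_root.
by have [y ->] := aut_rcons g v x; rewrite !size_rcons IH.
Qed.

Lemma take_aut (g : autT) v u : take (size v) (g (v ++ u)) = g v.
Proof.
elim/last_ind: u => [|u x IH]; first by rewrite cats0 -{1}(size_aut g) take_size.
rewrite -rcons_cat; have [y ->] := aut_rcons g (v ++ u) x.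
by rewrite -cats1 takel_cat // size_aut size_cat leq_addr.
Qed.

Definition sec_fun (g : autT) v : tree m -> tree m :=
  fun u => drop (size v) (g (v ++ u)).

Lemma sec_funE (g : autT) v u : g (v ++ u) = g v ++ sec_fun g v u.
Proof. by rewrite -{1}(take_aut g v u) cat_take_drop. Qed.

Lemma adjacent_cat w u v : adjacent (w ++ u) (w ++ v) <-> adjacent u v.
Proof.
have cc u1 v1 : child (w ++ u1) (w ++ v1) <-> child u1 v1.
  split=> -[x]; last by move=> ->; exists x; rewrite rcons_cat.
  by rewrite rcons_cat => /eqP; rewrite eqseq_cat // eqxx => /eqP ->; exists x.
by split=> -[/cc|/cc]; [left | right | left | right].
Qed.

Definition section (g : autT) v : autT.
Proof.
exists (sec_fun g v).
- exists (sec_fun (inv_aut g) (g v)) => u; rewrite {1}/sec_fun.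
    by rewrite -sec_funE inv_autK size_aut drop_size_cat.
  rewrite -{2}(inv_autK g v) -sec_funE inv_autVK.
  by rewrite -{1}(size_aut g) drop_size_cat.
- move=> u w; apply: iff_trans (iff_sym (adjacent_cat (g v) _ _)) _.
  by rewrite -!sec_funE; apply: iff_trans (aut_adj g _ _) (adjacent_cat _ _ _).
- by rewrite /sec_fun cats0 -(size_aut g) drop_size.
Defined.

Lemma sectionP (g : autT) v u : g (v * u) = g v * section g v u.
Proof. exact: sec_funE. Qed.

Definition st v : set autT := [set g | g v = v].

Definition St (n : nat) : set autT := [set g | forall v, size v = n -> g v = v].

Lemma St_sub n k : (n <= k)%N -> St k `<=` St n.
Proof.
move=> nk g gk; case=> [|x v] vn; first exact: aut_root.
have /gk : size ((x :: v) ++ nseq (k - n) x) = k.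
  by rewrite size_cat vn size_nseq subnKC.
rewrite sec_funE => /eqP; rewrite eqseq_cat ?size_aut //.
by case/andP=> /eqP.
Qed.

(* The congruence topology: the cosets [g * St n], n >= 1, form a neighborhood
   basis of [g]. *)
Definition congr_open (U : set autT) : Prop :=
  forall g, U g -> exists2 n : nat, (0 < n)%N & forall h, St n h -> U (g * h).

Let congr_openT : congr_open setT. Proof. by move=> g _; exists 1%N. Qed.

Let congr_openI : setI_closed congr_open.
Proof.
move=> U V oU oV g [/oU [n n0 Un] /oV [k k0 Vk]].
exists (maxn n k); first by rewrite leq_max n0.
move=> h hS; split; [apply: Un | apply: Vk]; apply: St_sub hS.
  exact: leq_maxl.
exact: leq_maxr.
Qed.

Let congr_open_bigU (I : Type) (f : I -> set autT) :
  (forall i, congr_open (f i)) -> congr_open (\bigcup_i f i).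
Proof.
move=> fo g [i _ /(fo i) [n n0 fn]]; exists n => // h hS.
by exists i => //; exact: fn.
Qed.

HB.instance Definition _ :=
  isOpenTopological.Build autT congr_openT congr_openI congr_open_bigU.

End Tree.

Arguments autT m : clear implicits.

Record closedSubgroup (m : nat) := ClosedSubgroup {
  cs_set :> set (autT m);
  cs_group : group_closed (mem cs_set);
  cs_closed : closed cs_set
}.

(* [set_type G] carries the topology induced from [autT m]. *)
Definition elt m (G : closedSubgroup m) : Type := set_type G.

HB.instance Definition _ m (G : closedSubgroup m) := SubChoice.on (elt G).
HB.instance Definition _ m (G : closedSubgroup m) := Topological.on (elt G).
HB.instance Definition _ m (G : closedSubgroup m) :=
  SubChoice_isSubGroup.Build _ _ (elt G) (cs_group G).
HB.instance Definition _ m (G : closedSubgroup m) :=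
  isPointed.Build (elt G) 1.

Definition borel (X : ptopologicalType) := g_sigma_algebraType (@open X).

Section SelfSimilarity.
Context {m : nat}.
Implicit Type G : closedSubgroup m.

Definition stG G v : set (autT m) := st v `&` G.
Definition StG G n : set (autT m) := St n `&` G.

(* Defined on all of [autT m], but a group morphism only on [st v]. *)
Definition phi (v : tree m) (g : autT m) : autT m := section g v.

Definition self_similar G : Prop :=
  forall (g : autT m) (v : tree m), cs_set G g -> cs_set G (section g v).

Definition fractal G : Prop :=
  self_similar G /\
  forall v : tree m, phi v @` stG G v = G.

Definition super_strongly_fractal G : Prop :=
  self_similar G /\
  forall (n : nat) (v : tree m), (0 < n)%N -> size v = n ->
    phi v @` StG G n = G.

Lemma section_in G (ss : self_similar G) (v : tree m) (g : elt G) :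
  section (val g) v \in cs_set G.
Proof. exact: mem_set (ss _ v (set_mem (valP g))). Qed.

Definition section_action G (ss : self_similar G) (v : tree m) (g : elt G) :
  elt G := exist _ (section (val g) v) (section_in ss v g).

(* Left invariance; on a compact group such as [G] a left Haar measure is
   automatically right invariant. *)
Definition is_Haar (R : realType) G (mu : probability (borel (elt G)) R) : Prop :=
  forall (g : elt G) (S : set (borel (elt G))), measurable S ->
    mu [set g * x | x in S] = mu S.

End SelfSimilarity.

Section Dynamics.
Context d (X : measurableType d) (R : realType) (mu : probability X R).

(* The law [act (a * b) x = act b (act a x)] is that of a right action, as
   satisfied by sections: g|_{vw} = (g|_v)|_w. *)
Definition is_action (A : monoidType) (act : A -> X -> X) : Prop :=
  (forall x, act 1 x = x) /\
  (forall a b x, act (a * b) x = act b (act a x)).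

Definition measure_preserving (A : monoidType) (act : A -> X -> X) : Prop :=
  forall a : A, measurable_fun setT (act a) /\
    forall S, measurable S -> mu (act a @^-1` S) = mu S.

Definition mp_system (A : monoidType) (act : A -> X -> X) : Prop :=
  is_action act /\ measure_preserving act.

(* Ergodicity and mixing are properties of measure-preserving systems, hence
   the first conjunct of the next two definitions. *)
Definition ergodic (A : monoidType) (act : A -> X -> X) : Prop :=
  mp_system act /\
  forall S, measurable S -> (forall a, act a @^-1` S = S) ->
    mu S = 0%E \/ mu S = 1%E.

Definition strongly_mixing (Y : choiceType) (act : freeMonoid Y -> X -> X) :
    Prop :=
  mp_system act /\
  forall S1 S2, measurable S1 -> measurable S2 ->
    forall a : nat -> freeMonoid Y, (forall k, a k <> 1) ->
      mu (act (\prod_(i < k.+1) a i) @^-1` S1 `&` S2) @[k --> \oo]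
        --> (mu S1 * mu S2)%E.

End Dynamics.

(* Main.v *)
Require Import Defs.
From mathcomp Require Import all_boot all_order all_algebra.
From mathcomp Require Import finmap.
From mathcomp Require Import ring.
From mathcomp Require Import all_classical all_reals all_analysis.

Set Implicit Arguments.
Unset Strict Implicit.
Unset Printing Implicit Defensive.

Import Order.TTheory GRing.Theory Num.Theory.
Import numFieldNormedType.Exports.

(** Everything rests on one observation about cosets. If [s] fixes the vertex
    [v], then [(s x)|_v = s|_v x|_v]; so when every [g] in [G] is the section at
    [v] of some [s] in [G] fixing [v], translating a set by [g] before pulling it
    back along the section map is the same as pulling it back and then
    translating by [s] ([preimage_section_mul]). The push-forward of Haar measure
    along such a section map is therefore left-invariant, and an invariant
    measure is determined by its total mass: at each level [n] the finitely many
    cylinders, i.e. cosets of the level stabilizer, have equal mass, and the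
    cylinders of all levels form a pi-system generating the Borel sets
    ([cylinder_invariant_unique]).

    The argument persists when Haar measure is first restricted to a set [C]
    that the elements [s] preserve, and yields
    [mu (T_v^-1 S `&` C) = mu S * mu C] ([section_independent]). For a fractal
    group take [C] the whole group: this is measure preservation. For a super
    strongly fractal group the [s] may be chosen to act trivially on the level
    of [v], hence to preserve every cylinder of lower level. So a section event
    [T_v^-1 S] is exactly independent of a cylinder as soon as [v] is longer
    than the level of the cylinder, whatever [S] is.

    Approximation then gives, for every Borel set [S2], that
    [mu (T_v^-1 S1 `&` S2)] tends to [mu S1 * mu S2] as the length of [v] grows,
    uniformly in [S1] and [v] ([super_uniformly_mixing]). Strong mixing follows,
    because a product of [k + 1] nonempty words has length greater than [k];
    ergodicity follows on taking [S1 = S2 = S] invariant, which forces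
    [mu S = mu S * mu S]. *)

(** * Cylinders of a closed subgroup *)
Section Cylinders.
Local Open Scope classical_set_scope.
Local Open Scope group_scope.
Context {m : nat} (G : closedSubgroup m).
Local Notation aut x := (\val x : autT m).
Implicit Types (x y g s : elt G) (v w : tree m) (n k : nat).

(** The left coset of the stabilizer of level [n] that contains [g].
    Agreement on level [n] already implies agreement on the shorter words; listing
    them makes monotonicity in [n] immediate. *)
Definition cylinder n g : set (elt G) :=
  [set x | forall v, (size v <= n)%N -> aut x v = aut g v].

Lemma cylinder_eq n g x : cylinder n g x -> cylinder n g = cylinder n x.
Proof.
move=> gx; apply/seteqP; split => y yP v vn.
  by rewrite yP // gx.
by rewrite yP // gx.
Qed.

Lemma cylinder_le n k g : (n <= k)%N -> cylinder k g `<=` cylinder n g.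
Proof. by move=> nk x gx v vn; apply: gx; exact: leq_trans nk. Qed.

Lemma cylinder0 g : cylinder 0 g = setT.
Proof. by apply/seteqP; split => // x _ [|//] _; rewrite !aut_root. Qed.

Lemma cylinderI n k g :
  cylinder n g `&` cylinder k g = cylinder (maxn n k) g.
Proof.
apply/seteqP; split => [x [nx kx] v|x gx].
  by rewrite leq_max => /orP[/nx|/kx].
by split; apply: cylinder_le gx; rewrite ?leq_maxl ?leq_maxr.
Qed.

Lemma aut_mul g x v : aut (g * x) v = aut x (aut g v).
Proof. by rewrite valM. Qed.

Lemma mul_cylinder n g x y :
  cylinder n (g * x) (g * y) <-> cylinder n x y.
Proof.
split=> xy v vn; last by rewrite !aut_mul xy // size_aut.
have := xy (inv_aut (val g) v); rewrite size_aut => /(_ vn).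
by rewrite !aut_mul inv_autVK.
Qed.

Lemma image_mul g (A : set (elt G)) :
  [set g * x | x in A] = [set x | A (g^-1 * x)].
Proof.
apply/seteqP; split=> [_ [x Ax <-]|x Ax] /=; first by rewrite mulKg.
by exists (g^-1 * x); rewrite ?mulVKg.
Qed.

Lemma image_mul_cylinder n g :
  [set g * x | x in cylinder n 1] = cylinder n g.
Proof.
rewrite image_mul; apply/seteqP; split=> x /=.
  by move/(mul_cylinder n g); rewrite mulg1 mulVKg.
by move=> gx; apply/(mul_cylinder n g); rewrite mulg1 mulVKg.
Qed.

(** The induced topology of [G] has the cylinders as a basis, so no later argument
    has to leave [G] for the ambient automorphism group. *)
Lemma open_cylinderP (U : set (elt G)) :
  open U <-> forall x, U x -> exists n, cylinder n x `<=` U.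
Proof.
split=> [[V oV <-] x /= Vx | UP].
  have [n n0 Vn] := oV _ Vx; exists n => y xy /=.
  change (V (aut y)).
  have -> : aut y = aut x * ((aut x)^-1 * aut y) by rewrite mulVKg.
  apply: Vn => v vn.
  change (aut y ((aut x)^-1 v) = v).
  by rewrite xy ?size_aut ?vn // -{2}(inv_autVK (val x) v).
(* The ambient open set is the union of the ambient cosets that meet [G] in one
   of the cylinders contained in [U]. *)
exists [set h : autT m | exists2 x, U x & exists2 n, cylinder n x `<=` U &
    forall v, (size v <= n)%N -> h v = aut x v]; last first.
  apply/seteqP; split=> [y [x _ [n xU xy]]|y Uy]; first exact: xU.
  by have [n yU] := UP _ Uy; exists y => //; exists n.
(* The level is [n.+1] because neighbourhoods are indexed by positive levels. *)
move=> g [x Ux [n xU gx]]; exists n.+1 => // h /St_sub hn; exists x => //.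
exists n => // v vn.
change (h (g v) = aut x v).
by rewrite -gx //; apply: hn (erefl); rewrite size_aut (leq_trans vn).
Qed.

(** A finite code for the cylinder of level [n] through [g]; its only use is to
    show that there are finitely many of them. Automorphisms preserve length, so
    the default value of [insub_bseq] is never taken. *)
Definition pattern n g : {ffun n.-bseq 'I_m -> n.-bseq 'I_m} :=
  [ffun v : n.-bseq 'I_m => insub_bseq n (aut g v)].

Lemma patternP n g x : (pattern n g == pattern n x) <-> cylinder n g x.
Proof.
split=> [/eqP /ffunP gx v vn|gx]; last first.
  by apply/eqP/ffunP => v; rewrite !ffunE gx // size_bseq.
have := congr1 (@bseqval _ _) (gx (Bseq vn)); rewrite !ffunE /=.
by rewrite /insub_bseq !insubdK // unfold_in size_aut.
Qed.

(** The empty set is included to make the family stable under intersection. *)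
Definition cylinders : set (set (elt G)) :=
  [set C | C = set0 \/ exists n g, C = cylinder n g].

Lemma cylinders_setI : setI_closed cylinders.
Proof.
move=> A B [->|[n [g ->]]]; first by rewrite set0I; left.
case=> [->|[k [h ->]]]; first by rewrite setI0; left.
have [->|/set0P[x [gx hx]]] := eqVneq (cylinder n g `&` cylinder k h) set0.
  by left.
right; exists (maxn n k), x.
by rewrite (cylinder_eq gx) (cylinder_eq hx) cylinderI.
Qed.

Lemma cylinder_open n g : open (cylinder n g).
Proof. by apply/open_cylinderP => x /cylinder_eq ->; exists n. Qed.

Lemma cylinder_measurable n g : measurable (cylinder n g : set (borel (elt G))).
Proof. exact: sub_sigma_algebra (cylinder_open n g). Qed.

(** Patterns of level [n] form a finite type, so this exhibits any union of
    cylinders of level [n] as a finite union of them. *)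
Lemma saturatedE n (A : set (elt G)) :
  (forall x, A x -> cylinder n x `<=` A) ->
  A = \bigcup_(t in [set pattern n x | x in A]) (pattern n @^-1` [set t]).
Proof.
move=> nA; apply/seteqP; split=> [x Ax|x [_ [y Ay <-] /=]].
  by exists (pattern n x) => //; exists x.
by move/esym/eqP/patternP; exact: nA.
Qed.

Lemma preimage_pattern n g : pattern n @^-1` [set pattern n g] = cylinder n g.
Proof.
by apply/seteqP; split=> x /=; [move/esym/eqP/patternP|move/patternP/eqP].
Qed.

(** An open set is the countable union over [n] of the unions of the level [n]
    cylinders that it contains, and each of these is a finite union. *)
Lemma borel_cylinders : @measurable _ (borel (elt G)) = <<s cylinders >>.
Proof.
apply/seteqP; split; apply: smallest_sub.
- exact: smallest_sigma_algebra.
- move=> U /open_cylinderP UP.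
  pose Un n := [set x | cylinder n x `<=` U].
  have -> : U = \bigcup_n Un n.
    apply/seteqP; split=> [x /UP [n nU]|x [n _ nU]]; first by exists n.
    exact: nU.
  apply: (@bigcupT_measurable _ (g_sigma_algebraType cylinders)) => n.
  rewrite (@saturatedE n (Un n)); last first.
    by move=> x xU y xy; rewrite /Un /= -(cylinder_eq xy).
  apply: (@fin_bigcup_measurable _ (g_sigma_algebraType cylinders)).
    exact: finite_finset.
  move=> _ [x _ <-]; rewrite preimage_pattern.
  by apply: sub_sigma_algebra; right; exists n, x.
- exact: sigma_algebra_measurable.
- by move=> _ [->|[n [g ->]]]; [exact: measurable0|exact: cylinder_measurable].
Qed.

(** * Invariant measures are determined by their total mass *)
Local Open Scope ring_scope.
Local Open Scope ereal_scope.
Context {R : realType}.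

(** Left invariance tested on cylinders only, where it can be checked without
    discussing the measurability of translates. *)
Definition cylinder_invariant (nu : {measure set (borel (elt G)) -> \bar R}) :=
  forall n g, nu (cylinder n g) = nu (cylinder n 1%g).

Lemma haar_cylinder_invariant (mu : probability (borel (elt G)) R) :
  is_Haar mu -> cylinder_invariant mu.
Proof.
move=> haar n g.
by have := haar g _ (@cylinder_measurable n 1%g); rewrite image_mul_cylinder.
Qed.

(** [N] is the index of the level [n] stabilizer: the group is the disjoint union
    of [N] cylinders of equal mass. The point is that [N] does not depend on the
    measure. *)
Lemma cylinder_index n : exists N : nat,
  forall nu : {measure set (borel (elt G)) -> \bar R}, cylinder_invariant nu ->
  nu (cylinder n 1%g) = N%:R^-1%:E * nu setT.
Proof.
pose I := [set pattern n x | x in @setT (elt G)].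
have finI : finite_set I by exact: finite_finset.
exists #|` fset_set I| => nu nuC.
apply/esym/eqP; rewrite eqe_pdivrMl; last first.
  rewrite pnatr_eq0 -lt0n cardfs_gt0; apply/fset0Pn; exists (pattern n 1%g).
  by rewrite in_fset_set // inE; exists 1%g.
apply/eqP; rewrite (@saturatedE n setT) // measure_fin_bigcup //.
- rewrite fsbig_finite //= (eq_big_seq (fun=> nu (cylinder n 1%g))).
    by rewrite big_const_seq count_predT iter_addr_0 // mule_natl.
  move=> t; rewrite in_fset_set // inE => -[x _ <-].
  by rewrite preimage_pattern nuC.
- by apply/trivIsetP => s t _ _ /eqP st; apply/seteqP; split=> // x [/= -> ts].
- by move=> _ [x _ <-]; rewrite preimage_pattern; exact: cylinder_measurable.
Qed.

Lemma cylinder_invariant_unique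
    (nu1 nu2 : {measure set (borel (elt G)) -> \bar R}) :
  cylinder_invariant nu1 -> cylinder_invariant nu2 ->
  nu1 setT < +oo -> nu1 setT = nu2 setT ->
  forall S, measurable S -> nu1 S = nu2 S.
Proof.
move=> inv1 inv2 fin1 eqT S mS.
apply: (@measure_unique _ R (borel (elt G)) cylinders (fun=> setT) _ _ _ _
  nu1 nu2) => //.
- exact: borel_cylinders.
- exact: cylinders_setI.
- by move=> _; right; exists 0%N, 1%g; rewrite cylinder0.
- by rewrite bigcup_const.
- move=> _ [->|[n [g ->]]]; first by rewrite !measure0.
  have [N NE] := cylinder_index n.
  by rewrite inv1 inv2 !NE // eqT.
Qed.

End Cylinders.

(** * Sections, translations and independence *)
Section Sections.
Local Open Scope classical_set_scope.
Local Open Scope group_scope.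
Context {m : nat} (G : closedSubgroup m) (ss : self_similar G).
Local Notation aut x := (\val x : autT m).
Local Notation act := (section_action ss).
Implicit Types (x y g s : elt G) (v w : tree m) (n k : nat).

Lemma section_is_action : is_action (act : tree m -> borel (elt G) -> _).
Proof.
split=> [x|v w x]; apply: val_inj; apply: autP => u /=; rewrite /sec_fun.
  by rewrite /= drop0.
by rewrite drop_drop size_cat addnC catA.
Qed.

Lemma section_cylinder n v x y :
  cylinder (size v + n) x y -> cylinder n (act v x) (act v y).
Proof.
move=> xy u un; change (sec_fun (aut y) v u = sec_fun (aut x) v u).
by rewrite /sec_fun xy // size_cat leq_add2l.
Qed.

Lemma section_measurable v :
  measurable_fun setT (act v : borel (elt G) -> borel (elt G)).
Proof.
apply: measurability => // _ [U oU <-]; rewrite setTI.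
apply: sub_sigma_algebra; apply/open_cylinderP => x Ux.
have [n nU] := (open_cylinderP U).1 oU _ Ux.
by exists (size v + n)%N => y /section_cylinder /nU.
Qed.

Lemma measurable_section_preimage v (A : set (borel (elt G))) : measurable A ->
  measurable (act v @^-1` A : set (borel (elt G))).
Proof.
by move=> mA; rewrite -[X in measurable X]setTI; exact: section_measurable.
Qed.

(** The cocycle identity [(s x)|_v = s|_v x|_(v^s)] where [v^s = v]. *)
Lemma section_mul v s x : st v (aut s) -> act v (s * x) = act v s * act v x.
Proof.
move=> sv; apply: val_inj; rewrite [RHS]valM; apply: autP => u.
change (drop (size v) (aut (s * x) (v ++ u)) =
        drop (size v) (aut x (v ++ sec_fun (aut s) v u))).
by rewrite aut_mul sec_funE sv.
Qed.

Lemma preimage_section_mul v s (A : set (elt G)) : st v (aut s) ->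
  [set s * x | x in act v @^-1` A] =
  act v @^-1` [set act v s * x | x in A].
Proof.
move=> sv; rewrite !image_mul; apply/seteqP; split=> x /=.
  by rewrite -{2}(mulVKg s x) (section_mul _ sv) mulKg.
by rewrite -{1}(mulVKg s x) (section_mul _ sv) mulKg.
Qed.

(** Used with [A] the stabilizer of [v] when [G] is fractal, and with [A] the
    stabilizer of the level of [v] when [G] is super strongly fractal. *)
Lemma section_lift v (A : set (autT m)) : phi v @` (A `&` G) = G ->
  forall g, exists2 s : elt G, A (aut s) & act v s = g.
Proof.
move=> phiA g; have [s [As Gs] sg] : (phi v @` (A `&` G)) (aut g).
  by rewrite phiA; exact: set_mem (valP g).
by exists (exist _ s (mem_set Gs)) => //; exact: val_inj.
Qed.

Local Open Scope ring_scope.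
Local Open Scope ereal_scope.
Context {R : realType} (mu : probability (borel (elt G)) R) (haar : is_Haar mu).

(** As functions of [S], both sides are measures of total mass [mu C]; the left
    one is cylinder-invariant because the translation of [S] by [g] lifts to the
    translation by [s] of [T_v^-1 S `&` C]. *)
Lemma section_independent v (C : set (borel (elt G))) : measurable C ->
  (forall g, exists s, [/\ st v (aut s), act v s = g &
     forall x, C (s * x)%g <-> C x]) ->
  forall S : set (borel (elt G)), measurable S ->
  mu (act v @^-1` S `&` C) = mu S * mu C.
Proof.
move=> mC sec S mS.
have mA := @measurable_section_preimage v.
have muC0 : (0 <= fine (mu C))%R by exact: fine_ge0.
have muC : mu C = (fine (mu C))%:E by rewrite fineK // fin_num_measure.
have [nu1 nu1E] : exists nu : {measure set (borel (elt G)) -> \bar R},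
    forall A, nu A = mu (act v @^-1` A `&` C).
  (* The measure structure of a push-forward depends on the measurability proof,
     which unification cannot guess. *)
  by exists (measure_function_pushforward__canonical__measure_function_Measure
    (mrestr mu mC) (section_measurable v)).
have [nu2 nu2E] : exists nu : {measure set (borel (elt G)) -> \bar R},
    forall A, nu A = mu A * mu C.
  exists (mscale (NngNum muC0) mu : {measure set _ -> \bar R}) => A.
  by rewrite muleC [in RHS]muC.
rewrite -nu1E -nu2E; apply: cylinder_invariant_unique => //.
- move=> n g; rewrite !nu1E; have [s [sv sg sC]] := sec g.
  have := haar s (measurableI _ _ (mA _ (@cylinder_measurable _ G n 1%g)) mC).
  move<-; congr (mu _).
  rewrite -[in LHS](image_mul_cylinder n g) -{1}sg -preimage_section_mul //.
  rewrite !image_mul; apply/seteqP; split => x /= [? Cx]; split => //.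
    by apply/sC; rewrite mulVKg.
  by move/sC : Cx; rewrite mulVKg.
- by move=> n g; rewrite !nu2E; congr (_ * _); exact: haar_cylinder_invariant.
- by rewrite nu1E preimage_setT setTI muC ltry.
- by rewrite nu1E nu2E preimage_setT setTI probability_setT mul1e.
Qed.

Lemma fractal_mp_system : fractal G ->
  mp_system mu (act : tree m -> borel (elt G) -> _).
Proof.
move=> [_ frac]; split; first exact: section_is_action.
move=> v; split; first exact: section_measurable.
move=> S mS; rewrite -[LHS]mule1 -(probability_setT mu).
rewrite -[X in mu X * _]setIT section_independent ?probability_setT ?mule1 //.
by move=> g; have [s sv sg] := section_lift (frac v) g; exists s.
Qed.

(** The lifts may be taken in the stabilizer of the level of [v]; acting trivially
    on levels up to [n], they preserve the cylinder. *)
Lemma super_section_independent n v g (S : set (borel (elt G))) :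
  super_strongly_fractal G -> (n < size v)%N -> measurable S ->
  mu (act v @^-1` S `&` cylinder n g) = mu S * mu (cylinder n g).
Proof.
move=> [_ frac] nv mS; apply: section_independent => //.
  exact: cylinder_measurable.
move=> h; have v0 : (0 < size v)%N by exact: leq_ltn_trans nv.
have [s sv sh] := section_lift (frac _ _ v0 erefl) h.
exists s; split => [||x] //; first exact: sv.
have sw w : (size w <= n)%N -> aut (s * x)%g w = aut x w.
  by move=> wn; rewrite aut_mul (St_sub (ltnW (leq_ltn_trans wn nv)) sv erefl).
by split=> gx w wn; rewrite -gx // sw.
Qed.

(** For nonempty [v] the level stabilizer already maps onto [G]; at the root the
    section map is the identity. *)
Lemma super_fractal : super_strongly_fractal G -> fractal G.
Proof.
move=> [_ frac]; split=> // v; apply/seteqP; split.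
  by move=> _ [g [_ Gg] <-]; exact: ss.
case: (posnP (size v)) => [/size0nil ->|v0].
  move=> g Gg; exists g; first by split; [exact: aut_root|].
  by apply: autP => u; rewrite /= /sec_fun drop0.
rewrite -[X in X `<=` _](frac _ _ v0 erefl) => _ [s [sv Gs] <-].
by exists s => //; split => //; exact: sv.
Qed.

(** * Uniform mixing *)

(** Real-valued probabilities, so that differences can be estimated with ordinary
    absolute values. *)
Let p (A : set (borel (elt G))) : R := fine (mu A).

Let muE (A : set (borel (elt G))) : measurable A -> mu A = (p A)%:E.
Proof. by move=> mA; rewrite fineK // fin_num_measure. Qed.

Let p_ge0 A : (0 <= p A)%R. Proof. exact: fine_ge0. Qed.

Let p_le A B : measurable A -> measurable B -> A `<=` B -> (p A <= p B)%R.
Proof.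
by move=> mA mB AB; rewrite -lee_fin -!muE //; apply: le_measure; rewrite ?inE.
Qed.

Let p_le1 A : measurable A -> (p A <= 1)%R.
Proof. by move=> mA; rewrite -lee_fin -muE //; exact: probability_le1. Qed.

Let pD A B : measurable A -> measurable B -> B `<=` A ->
  p (A `\` B) = (p A - p B)%R.
Proof.
move=> mA mB BA; apply: EFin_inj; rewrite EFinB -!muE //.
  rewrite measureD ?(setIidr BA) //.
  by apply: (le_lt_trans (probability_le1 mu mA)); rewrite ltry.
exact: measurableD.
Qed.

Local Open Scope ring_scope.

(** The bound depends neither on [S1] nor on [v] beyond its length. This
    uniformity lets the property pass to increasing limits in [S2], and it covers
    every sequence of words at once. *)
Definition uniformly_mixing (S2 : set (borel (elt G))) :=
  forall e : R, 0 < e -> exists N : nat, forall v : tree m, (N <= size v)%N ->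
  forall S1 : set (borel (elt G)), measurable S1 ->
  `|p (act v @^-1` S1 `&` S2) - p S1 * p S2| <= e.

Lemma uniformly_mixing_setD (A B : set (borel (elt G))) : B `<=` A ->
  measurable A /\ uniformly_mixing A -> measurable B /\ uniformly_mixing B ->
  measurable (A `\` B) /\ uniformly_mixing (A `\` B).
Proof.
move=> BA [mA mixA] [mB mixB]; split; first exact: measurableD.
move=> e e0; have e20 : 0 < e / 2 by rewrite divr_gt0.
have [NA hA] := mixA _ e20; have [NB hB] := mixB _ e20.
exists (maxn NA NB) => v; rewrite geq_max => /andP[/hA {}hA /hB {}hB] S1 mS1.
have mP := measurable_section_preimage v mS1.
have -> : act v @^-1` S1 `&` (A `\` B) =
  (act v @^-1` S1 `&` A) `\` (act v @^-1` S1 `&` B).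
  by apply/seteqP; split=> x /= => [[? [? ?]]|[[? ?] nB]];
    [split=> // -[]|split=> //; split=> // ?; exact: nB].
rewrite !pD //; [|exact: measurableI|exact: measurableI|exact: setIS].
have -> : p (act v @^-1` S1 `&` A) - p (act v @^-1` S1 `&` B) -
    p S1 * (p A - p B) =
  (p (act v @^-1` S1 `&` A) - p S1 * p A) -
  (p (act v @^-1` S1 `&` B) - p S1 * p B) by ring.
rewrite [e]splitr; apply: le_trans (ler_normB _ _) _.
by apply: lerD; [exact: hA|exact: hB].
Qed.

(** Replacing the union [U] by [F n] changes each of the two terms by at most
    [p (U `\` F n)], which is small independently of [S1] and [v]. *)
Lemma uniformly_mixing_bigcup (F : (set (borel (elt G)))^nat) :
  nondecreasing_seq F ->
  (forall n, measurable (F n) /\ uniformly_mixing (F n)) ->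
  measurable (\bigcup_n F n) /\ uniformly_mixing (\bigcup_n F n).
Proof.
move=> ndF FP; have mF n : measurable (F n) by have [] := FP n.
pose U := \bigcup_n F n.
have mU : measurable U by exact: bigcup_measurable.
split=> // e e0; have e30 : 0 < e / 3 by rewrite divr_gt0.
have pF : p (F n) @[n --> \oo] --> p U.
  apply: fine_cvg; rewrite -/U -muE //.
  exact: nondecreasing_cvg_mu.
have /cvgrPdist_le /(_ _ e30) [n _ /(_ n (leqnn n)) /=] := pF.
have FU : F n `<=` U by exact: bigcup_sup.
rewrite -pD // => /(le_trans (ler_norm _)) pUF.
have [N hN] := (FP n).2 _ e30.
exists N => v Nv S1 mS1; have mP := measurable_section_preimage v mS1.
have {}hN := hN v Nv S1 mS1.
have d1 : `|p (act v @^-1` S1 `&` U) - p (act v @^-1` S1 `&` F n)| <= e / 3.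
  rewrite -pD; [|exact: measurableI|exact: measurableI|exact: setIS].
  rewrite ger0_norm //; apply: le_trans pUF; apply: p_le.
  - by apply: measurableD; exact: measurableI.
  - exact: measurableD.
  - by move=> x [[? ?] nF]; split=> // ?; exact: nF.
have d2 : `|p S1 * p (F n) - p S1 * p U| <= e / 3.
  rewrite -mulrBr normrM distrC -pD // !ger0_norm //.
  by apply: le_trans pUF; rewrite ler_piMl // p_le1.
have -> : e = e / 3 + e / 3 + e / 3 by field.
rewrite -/U.
have -> : p (act v @^-1` S1 `&` U) - p S1 * p U =
  (p (act v @^-1` S1 `&` U) - p (act v @^-1` S1 `&` F n)) +
  (p (act v @^-1` S1 `&` F n) - p S1 * p (F n)) + (p S1 * p (F n) - p S1 * p U).
  by ring.
apply: le_trans (ler_normD _ _) _; apply: lerD d2.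
by apply: le_trans (ler_normD _ _) _; apply: lerD hN.
Qed.

(** The pi-lambda theorem: on cylinders the discrepancy is zero for long [v], and
    the sets with the property form a lambda-system. *)
Lemma super_uniformly_mixing (S2 : set (borel (elt G))) :
  super_strongly_fractal G -> measurable S2 -> uniformly_mixing S2.
Proof.
move=> frac.
have cyl n g : measurable (cylinder n g : set (borel (elt G))) /\
    uniformly_mixing (cylinder n g).
  split; first exact: cylinder_measurable.
  move=> e e0; exists n.+1 => v nv S1 mS1.
  rewrite /p super_section_independent // fineM; last 2 first.
  - exact: fin_num_measure.
  - by apply: fin_num_measure; exact: cylinder_measurable.
  by rewrite subrr normr0 ltW.
rewrite borel_cylinders => S2m.
suff sub : <<s @cylinders m G>> `<=`
    [set A : set (elt G) | measurable (A : set (borel (elt G))) /\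
                           uniformly_mixing A] by have [] := sub _ S2m.
apply: lambda_system_subset; first exact: cylinders_setI.
- split=> //.
  + by rewrite -(cylinder0 (1%g : elt G)); exact: cyl.
  + exact: uniformly_mixing_setD.
  + exact: uniformly_mixing_bigcup.
- move=> _ [->|[n [g ->]]]; last exact: cyl.
  split; first exact: measurable0.
  move=> e e0; exists 0%N => v _ S1 _.
  by rewrite setI0 /p measure0 mulr0 subrr normr0 ltW.
- by [].
Qed.

(** An invariant set is asymptotically independent of itself. The hypothesis
    [0 < m] supplies arbitrarily long words. *)
Lemma super_ergodic : (0 < m)%N -> super_strongly_fractal G ->
  ergodic mu (act : tree m -> borel (elt G) -> _).
Proof.
move=> m0 frac; split; first exact/fractal_mp_system/super_fractal.
move=> S mS inv.
have pS : p S - p S * p S = 0.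
  apply/eqP; rewrite -normr_le0; apply/ler_addgt0Pl => e e0; rewrite addr0.
  have [N] := super_uniformly_mixing frac mS e0.
  move=> /(_ (nseq N (Ordinal m0))); rewrite size_nseq => /(_ (leqnn N) S mS).
  by rewrite inv setIid.
move/eqP : pS; rewrite -{1}[p S]mulr1 -mulrBr mulf_eq0 subr_eq0 muE //.
by case/orP=> /eqP; [left|right]; congr EFin.
Qed.

Lemma size_prod_words (a : nat -> tree m) k :
  (forall i, a i <> [::]) -> (k < size (\prod_(i < k.+1) a i)%g)%N.
Proof.
move=> a1; have sa i : (0 < size (a i))%N by rewrite lt0n size_eq0; apply/eqP.
elim: k => [|k IH]; first by rewrite big_ord_recr big_ord0 /= mul1g.
rewrite big_ord_recr /= size_cat -addn1.
exact: leq_add.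
Qed.

Lemma super_strongly_mixing : super_strongly_fractal G ->
  strongly_mixing mu (act : tree m -> borel (elt G) -> _).
Proof.
move=> frac; split; first exact/fractal_mp_system/super_fractal.
move=> S1 S2 mS1 mS2 a a1; rewrite !muE // -EFinM.
have mk k : measurable (act (\prod_(i < k.+1) a i)%g @^-1` S1 `&` S2 :
    set (borel (elt G))).
  by apply: measurableI => //; exact: measurable_section_preimage.
under eq_fun do rewrite muE //.
apply: cvg_EFin; first by near=> k.
apply/cvgrPdist_le => e e0.
have [N hN] := super_uniformly_mixing frac mS2 e0.
near=> k; rewrite distrC; apply: hN => //.
apply: ltnW; apply: leq_ltn_trans (size_prod_words k a1).
by near: k; exact: nbhs_infty_ge.
Unshelve. all: by end_near. Qed.

End Sections.

Theorem theorem1 (R : realType) (m : nat) (hm : (0 < m)%N)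
  (G : closedSubgroup m) (ss : self_similar G)
  (mu : probability (borel (elt G)) R) (hmu : is_Haar mu) :
  (fractal G -> mp_system mu (section_action ss)) /\
  (super_strongly_fractal G ->
     ergodic mu (section_action ss) /\ strongly_mixing mu (section_action ss)).
Proof.
split; first exact: fractal_mp_system.
by move=> frac; split; [exact: super_ergodic|exact: super_strongly_mixing].
Qed.
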